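(* Let $\mathbf U=\langle\langle U,\approx\rangle,\preceq\rangle$ be a completely lattice $\mathbf L$-ordered set and $\sim$ a complete $\mathbf L$-tolerance on $\mathbf U$. The maximal blocks of $\sim$ are exactly the $\mathbf L$-intervals $[\![v,u]\!]$ where $\langle u,v\rangle$ ranges over the fixpoints of $\langle{}_\sim,{}^\sim\rangle$, i.e. the pairs $u,v\in U$ with $u_\sim=v$ and $v^\sim=u$.
   Context: $\mathbf L=\langle L,\wedge,\vee,\otimes,\to,0,1\rangle$ is a complete residuated lattice ($\langle L,\wedge,\vee,0,1\rangle$ complete lattice, $\langle L,\otimes,1\rangle$ commutative monoid, $a\otimes b\le c$ iff $a\le b\to c$). An $\mathbf L$-set in $X$ is a map $X\to L$; $L^X$ the set of them; $A\subseteq B$ iff $A(x)\le B(x)$ for all $x$; $S(A,B)=\bigwedge_x(A(x)\to B(x))$. An $\mathbf L$-equality is a binary $\mathbf L$-relation that is reflexive, symmetric, transitive ($R(x,y)\otimes R(y,z)\le R(x,z)$) and with $R(x,y)=1\Rightarrow x=y$. An $\mathbf L$-ordered set is $\langle\langle U,\approx\rangle,\preceq\rangle$, $\approx$ an $\mathbf L$-equality, $\preceq$ reflexive, transitive, compatible with $\approx$ ($(u\preceq v)\otimes(u\approx u')\otimes(v\approx v')\le(u'\preceq v')$), and $(u\preceq v)\wedge(v\preceq u)\le u\approx v$; $u\le v$ means $(u\preceq v)=1$. For $V\in L^U$: $\mathcal L V(v)=\bigwedge_u(V(u)\to(v\preceq u))$, $\mathcal U V(v)=\bigwedge_u(V(u)\to(u\preceq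 v))$; $\inf V$ is the unique $u$ with $\mathcal L V(u)=1=\mathcal U(\mathcal L V)(u)$, $\sup V$ the unique $u$ with $\mathcal U V(u)=1=\mathcal L(\mathcal U V)(u)$; completely lattice means these exist for all $V$. For $v\le u$, $[\![v,u]\!](w)=(v\preceq w)\wedge(w\preceq u)$. Power relation: for $R$ on $X$, $A,B\in L^X$, $(R\circ B)(x)=\bigvee_y R(x,y)\otimes B(y)$, $(A\circ R)(y)=\bigvee_x A(x)\otimes R(x,y)$, $R^+(A,B)=S(A,R\circ B)\wedge S(B,A\circ R)$. A binary $\mathbf L$-relation $R$ on $\mathbf U$ is complete if it is compatible with $\approx$ ($R(u,v)\otimes(u\approx u')\otimes(v\approx v')\le R(u',v')$) and $R^+(V_1,V_2)\le R(\inf V_1,\inf V_2)$, $R^+(V_1,V_2)\le R(\sup V_1,\sup V_2)$ for all $V_1,V_2\in L^U$. An $\mathbf L$-tolerance is a reflexive symmetric binary $\mathbf L$-relation. A block of $\sim$ is $B\in L^U$ with $B(x_1)\otimes B(x_2)\le x_1\sim x_2$ for all $x_1,x_2$; it is maximal if every block $B'$ with $B\subseteq B'$ equals $B$. For $u\in U$, $[u]_\sim(v)=u\sim v$, $u_\sim=\inf[u]_\sim$, $u^\sim=\sup[u]_\sim$. *)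

(* Defs.v *)
From HB Require Import structures.
From mathcomp Require Import all_boot all_order.
From mathcomp Require Import boolp classical_sets.
Set Implicit Arguments.
Unset Strict Implicit.
Unset Printing Implicit Defensive.
Import Order.TTheory.
Local Open Scope classical_set_scope.
Local Open Scope order_scope.

Reserved Notation "a ⊗ b" (at level 40, left associativity).
Reserved Notation "a ⇒ b" (at level 55, right associativity).
Declare Scope reslat_scope.
Delimit Scope reslat_scope with RL.

(* The unit of the product is the greatest element \top (integrality);
   \bot = \top is not excluded. *)
HB.mixin Record isCompleteResiduated d L of Order.TBLattice d L := {
  tensor : L -> L -> L;
  residuum : L -> L -> L;
  tensorA : associative tensor;
  tensorC : commutative tensor;
  tensor1x : left_id (\top : L) tensor;
  tensor_residuum : forall a b c : L,
    (tensor a b <= c) = (a <= residuum b c);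
  supremums_ex : forall A : set L, supremums A !=set0;
  infimums_ex : forall A : set L, infimums A !=set0
}.

#[short(type="completeResiduatedLatticeType")]
HB.structure Definition CompleteResiduatedLattice d :=
  {L of isCompleteResiduated d L & Order.TBLattice d L}.

Notation "a ⊗ b" := (tensor a b) : reslat_scope.
Notation "a ⇒ b" := (residuum a b) : reslat_scope.
Local Open Scope reslat_scope.

Section LSets.
Context {d : Order.disp_t} {L : completeResiduatedLatticeType d}.

(* [supremum x0] and [infimum x0] return x0 on the empty set, hence the
   choice of \bot and \top. *)
Definition bigjoin (I : Type) (f : I -> L) : L := supremum \bot (range f).
Definition bigmeet (I : Type) (f : I -> L) : L := infimum \top (range f).

Lemma bigjoin_ub (I : Type) (f : I -> L) i : f i <= bigjoin f.
Proof.
have fi : range f (f i) by exists i.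
rewrite /bigjoin /supremum; case: ifPn => [/eqP f0|_]; first by rewrite f0 in fi.
have [x xf] := supremums_ex (range f).
by case: xgetP => [y _ [fy _]|/(_ x)//]; exact: fy.
Qed.

Lemma bigjoin_le (I : Type) (f : I -> L) a :
  (forall i, f i <= a) -> bigjoin f <= a.
Proof.
move=> fa; rewrite /bigjoin /supremum; case: ifPn => [_|_]; first exact: le0x.
case: xgetP => [y _ [_ fy]|_]; last exact: le0x.
by apply: fy => _ [i _ <-].
Qed.

Lemma bigmeet_lb (I : Type) (f : I -> L) i : bigmeet f <= f i.
Proof.
have fi : range f (f i) by exists i.
rewrite /bigmeet /infimum; case: ifPn => [/eqP f0|_]; first by rewrite f0 in fi.
have [x xf] := infimums_ex (range f).
by case: xgetP => [y _ [fy _]|/(_ x)//]; exact: fy.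
Qed.

Lemma bigmeet_ge (I : Type) (f : I -> L) a :
  (forall i, a <= f i) -> a <= bigmeet f.
Proof.
move=> fa; rewrite /bigmeet /infimum; case: ifPn => [_|_]; first exact: lex1.
case: xgetP => [y _ [_ fy]|_]; last exact: lex1.
by apply: fy => _ [i _ <-].
Qed.

Lemma residuum_eq1 (a b : L) : a ⇒ b = \top <-> a <= b.
Proof.
rewrite -{2}(tensor1x a) tensor_residuum; split=> [->//|h].
by apply/eqP; rewrite -le1x.
Qed.

Definition Lsubset (X : Type) (A B : X -> L) : Prop := forall x, A x <= B x.

Definition subsethood (X : Type) (A B : X -> L) : L :=
  bigmeet (fun x => A x ⇒ B x).

Definition Lreflexive (X : Type) (R : X -> X -> L) : Prop :=
  forall x, R x x = \top.
Definition Lsymmetric (X : Type) (R : X -> X -> L) : Prop :=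
  forall x y, R x y = R y x.
Definition Ltransitive (X : Type) (R : X -> X -> L) : Prop :=
  forall x y z, R x y ⊗ R y z <= R x z.

Definition Lequality (X : Type) (R : X -> X -> L) : Prop :=
  [/\ Lreflexive R, Lsymmetric R, Ltransitive R &
      forall x y, R x y = \top -> x = y].

Definition Lcompatible (X : Type) (E R : X -> X -> L) : Prop :=
  forall u v u' v', R u v ⊗ E u u' ⊗ E v v' <= R u' v'.

Definition Ltolerance (X : Type) (R : X -> X -> L) : Prop :=
  Lreflexive R /\ Lsymmetric R.

Definition rel_comp_set (X : Type) (R : X -> X -> L) (B : X -> L) : X -> L :=
  fun x => bigjoin (fun y => R x y ⊗ B y).
Definition set_comp_rel (X : Type) (A : X -> L) (R : X -> X -> L) : X -> L :=
  fun y => bigjoin (fun x => A x ⊗ R x y).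

Definition power_rel (X : Type) (R : X -> X -> L) (A B : X -> L) : L :=
  subsethood A (rel_comp_set R B) `&` subsethood B (set_comp_rel A R).

Definition block (X : Type) (R : X -> X -> L) (B : X -> L) : Prop :=
  forall x1 x2, B x1 ⊗ B x2 <= R x1 x2.

Definition maximal_block (X : Type) (R : X -> X -> L) (B : X -> L) : Prop :=
  block R B /\ forall B', block R B' -> Lsubset B B' -> B' = B.

Definition Lclass (X : Type) (R : X -> X -> L) (u : X) : X -> L :=
  fun v => R u v.

End LSets.

Record LorderedSet (d : Order.disp_t) (L : completeResiduatedLatticeType d) :=
  MkLorderedSet {
    Lcarrier :> Type;
    Leq : Lcarrier -> Lcarrier -> L;
    Lle : Lcarrier -> Lcarrier -> L;
    Leq_Lequality : Lequality Leq;
    Lle_refl : Lreflexive Lle;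
    Lle_trans : Ltransitive Lle;
    Lle_compat : Lcompatible Leq Lle;
    Lle_antisym : forall u v, Lle u v `&` Lle v u <= Leq u v
  }.
Arguments Leq {d L U} _ _ : rename.
Arguments Lle {d L U} _ _ : rename.

Section LOrderedSets.
Context {d : Order.disp_t} {L : completeResiduatedLatticeType d}.
Context {U : LorderedSet L}.

Definition lower_cone (V : U -> L) : U -> L :=
  fun v => bigmeet (fun u => V u ⇒ Lle v u).
Definition upper_cone (V : U -> L) : U -> L :=
  fun v => bigmeet (fun u => V u ⇒ Lle u v).

Definition is_inf (V : U -> L) (u : U) : Prop :=
  lower_cone V u = \top /\ upper_cone (lower_cone V) u = \top.
Definition is_sup (V : U -> L) (u : U) : Prop :=
  upper_cone V u = \top /\ lower_cone (upper_cone V) u = \top.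

Lemma Lle_anti (u v : U) : Lle u v = \top -> Lle v u = \top -> u = v.
Proof.
move=> uv vu; have [_ _ _ sep] := Leq_Lequality U; apply: sep.
by apply/eqP; rewrite -le1x (le_trans _ (Lle_antisym u v))// uv vu meetxx.
Qed.

Lemma is_inf_unique V u u' : is_inf V u -> is_inf V u' -> u = u'.
Proof.
have H w w' : is_inf V w -> is_inf V w' -> Lle w w' = \top.
  move=> [lw _] [_ ulw']; apply/eqP; rewrite -le1x -[leLHS]lw.
  by apply/residuum_eq1/eqP; rewrite -le1x -[leLHS]ulw'; exact: bigmeet_lb.
by move=> Hu Hu'; apply: Lle_anti; exact: H.
Qed.

Lemma is_sup_unique V u u' : is_sup V u -> is_sup V u' -> u = u'.
Proof.
have H w w' : is_sup V w -> is_sup V w' -> Lle w' w = \top.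
  move=> [lw _] [_ ulw']; apply/eqP; rewrite -le1x -[leLHS]lw.
  by apply/residuum_eq1/eqP; rewrite -le1x -[leLHS]ulw'; exact: bigmeet_lb.
by move=> Hu Hu'; apply: Lle_anti; exact: H.
Qed.

(* [[v, u]], as a total operation; it is an L-interval only when
   Lle v u = \top, see [fixpoint_Lle] below. *)
Definition Linterval (v u : U) : U -> L := fun w => Lle v w `&` Lle w u.

End LOrderedSets.

Definition completely_lattice (d : Order.disp_t)
    (L : completeResiduatedLatticeType d) (U : LorderedSet L) : Prop :=
  forall V : U -> L, (exists u, is_inf V u) /\ (exists u, is_sup V u).

Section CompletelyLattice.
Context {d : Order.disp_t} {L : completeResiduatedLatticeType d}.
Context {U : LorderedSet L} (HU : completely_lattice U).

Definition Linf (V : U -> L) : U := projT1 (cid (HU V).1).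
Definition Lsup (V : U -> L) : U := projT1 (cid (HU V).2).

Lemma LinfP V : is_inf V (Linf V).
Proof. exact: projT2 (cid (HU V).1). Qed.

Lemma LsupP V : is_sup V (Lsup V).
Proof. exact: projT2 (cid (HU V).2). Qed.

Definition complete_rel (R : U -> U -> L) : Prop :=
  [/\ Lcompatible Leq R,
      forall V1 V2, power_rel R V1 V2 <= R (Linf V1) (Linf V2) &
      forall V1 V2, power_rel R V1 V2 <= R (Lsup V1) (Lsup V2)].

Definition tol_inf (R : U -> U -> L) (u : U) : U := Linf (Lclass R u).
Definition tol_sup (R : U -> U -> L) (u : U) : U := Lsup (Lclass R u).

Definition tol_fixpoint (R : U -> U -> L) (u v : U) : Prop :=
  tol_inf R u = v /\ tol_sup R v = u.

Lemma fixpoint_Lle R u v :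
  Ltolerance R -> tol_fixpoint R u v -> Lle v u = \top.
Proof.
move=> [Rr _] [<- _]; have [lw _] := LinfP (Lclass R u).
apply/eqP; rewrite -le1x -[leLHS](Rr u).
apply/residuum_eq1/eqP; rewrite -le1x -[leLHS]lw.
exact: (bigmeet_lb (fun w => Lclass R u w ⇒ Lle (tol_inf R u) w) u).
Qed.

End CompletelyLattice.

(* Main.v *)
(** The blocks of [R] are controlled by crisp intervals [[v, u]] with
    [R u v = \top]. Completeness applied to a singleton and an L-set shows that
    [u] is fully related to [tol_inf u] and [tol_sup u], and that every block is
    contained in such an interval. Conversely such an interval is a block:
    an arbitrary [x] is similar, to the degree to which it lies in [[v, u]], to
    [(x /\ u) \/ v], which lies fully in [[v, u]], and for elements lying fully
    in [[v, u]] the classical lattice argument applies. Finally, enlarging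
    [[v, u]] to [[tol_inf u, tol_sup (tol_inf u)]] yields a fixpoint. *)
Require Import Defs.
From mathcomp Require Import all_boot all_order.
From mathcomp Require Import boolp classical_sets.
Import Order.TTheory.
Local Open Scope classical_set_scope.
Local Open Scope order_scope.
Local Open Scope reslat_scope.
Set Implicit Arguments.
Unset Strict Implicit.
Unset Printing Implicit Defensive.

(** * Crisp L-sets and lower bounds for the power relation *)

Section ResiduatedLattice.
Context {d : Order.disp_t} {L : completeResiduatedLatticeType d}.
Implicit Types a b c : L.

Lemma tensorx1 a : a ⊗ \top = a.
Proof. by rewrite tensorC tensor1x. Qed.

Lemma le_tensor a b a' b' : a <= a' -> b <= b' -> a ⊗ b <= a' ⊗ b'.
Proof.
move=> aa' bb'; apply: (@le_trans _ _ (a' ⊗ b)).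
  by rewrite tensor_residuum (le_trans aa')// -tensor_residuum.
by rewrite tensorC [leRHS]tensorC tensor_residuum (le_trans bb')// -tensor_residuum.
Qed.

Lemma top_le a : \top <= a -> a = \top.
Proof. by rewrite le1x => /eqP. Qed.

Definition crisp (X : Type) (A : set X) (x : X) : L :=
  if `[< A x >] then \top else \bot.

Lemma crispT (X : Type) (A : set X) x : A x -> crisp A x = \top.
Proof. by rewrite /crisp => /asboolP ->. Qed.

Lemma tensor_crisp_le (X : Type) (A : set X) x a c :
  (A x -> c <= a) -> c ⊗ crisp A x <= a.
Proof.
rewrite /crisp; case: asboolP => [Ax /(_ Ax)|_ _]; first by rewrite tensorx1.
by rewrite tensorC tensor_residuum le0x.
Qed.

Lemma power_rel_ge (X : Type) (R : X -> X -> L) (A B : X -> L) c :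
  (forall x, exists y, c ⊗ A x <= R x y ⊗ B y) ->
  (forall y, exists x, c ⊗ B y <= A x ⊗ R x y) -> c <= power_rel R A B.
Proof.
move=> AB BA; rewrite lexI; apply/andP; split; apply: bigmeet_ge => x;
  rewrite -tensor_residuum.
  by have [y] := AB x; move/le_trans; apply; exact: (bigjoin_ub _ y).
by have [y] := BA x; move/le_trans; apply; exact: (bigjoin_ub _ y).
Qed.

(** Only [x] lies in the singleton, so one witness [y] serves one direction, and [x] is the witness
    for every [z] in the other. *)
Lemma power_rel_crisp1 (X : Type) (R : X -> X -> L) (B : X -> L) x y c :
  c <= R x y ⊗ B y -> (forall z, c ⊗ B z <= R x z) ->
  c <= power_rel R (crisp [set x]) B.
Proof.
move=> cxy cB; apply: power_rel_ge => z.
  by exists y; apply: tensor_crisp_le => ->.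
by exists x; rewrite crispT// tensor1x.
Qed.

Lemma power_rel_crisp2 (X : Type) (R : X -> X -> L) x1 x2 y1 y2 :
  R x1 y1 = \top -> R x2 y2 = \top ->
  \top <= power_rel R (crisp [set x1; x2]) (crisp [set y1; y2]).
Proof.
move=> R1 R2; apply: power_rel_ge => z.
(* Off [x1], the witness [y2] serves every [z]: either [z] is [x2], or its crisp degree is
   [\bot]. *)
- have [->|z1] := pselect (z = x1).
    by exists y1; rewrite R1 [crisp _ y1]crispT ?tensorx1 ?lex1//; left.
  exists y2; apply: tensor_crisp_le => -[//|->].
  by rewrite R2 crispT ?tensorx1//; right.
- have [->|z1] := pselect (z = y1).
    by exists x1; rewrite R1 [crisp _ x1]crispT ?tensorx1 ?lex1//; left.
  exists x2; apply: tensor_crisp_le => -[//|->].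
  by rewrite R2 crispT ?tensorx1//; right.
Qed.

End ResiduatedLattice.

(** * Infima and suprema of crisp sets *)

Section InfSup.
Context {d : Order.disp_t} {L : completeResiduatedLatticeType d}.
Context {U : LorderedSet L}.
Implicit Types (V : U -> L) (A : set U) (u v w : U).

Lemma Lle_trans1 u v w : Lle u v = \top -> Lle v w <= Lle u w.
Proof. by move=> uv; rewrite -[leLHS]tensor1x -uv; exact: Lle_trans. Qed.

Lemma Lle_trans2 u v w : Lle v w = \top -> Lle u v <= Lle u w.
Proof. by move=> vw; rewrite -[leLHS]tensorx1 -vw; exact: Lle_trans. Qed.

Lemma is_infP V u : is_inf V u <->
  (forall w, V w <= Lle u w) /\ (forall w, lower_cone V w <= Lle w u).
Proof.
split=> -[lb glb]; split.
- by move=> w; apply/residuum_eq1/top_le; rewrite -[leLHS]lb; exact: bigmeet_lb.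
- by move=> w; apply/residuum_eq1/top_le; rewrite -[leLHS]glb; exact: bigmeet_lb.
- by apply/top_le/bigmeet_ge => w; rewrite (residuum_eq1 _ _).2.
- by apply/top_le/bigmeet_ge => w; rewrite (residuum_eq1 _ _).2.
Qed.

Lemma is_supP V u : is_sup V u <->
  (forall w, V w <= Lle w u) /\ (forall w, upper_cone V w <= Lle u w).
Proof.
split=> -[ub lub]; split.
- by move=> w; apply/residuum_eq1/top_le; rewrite -[leLHS]ub; exact: bigmeet_lb.
- by move=> w; apply/residuum_eq1/top_le; rewrite -[leLHS]lub; exact: bigmeet_lb.
- by apply/top_le/bigmeet_ge => w; rewrite (residuum_eq1 _ _).2.
- by apply/top_le/bigmeet_ge => w; rewrite (residuum_eq1 _ _).2.
Qed.

Lemma crisp_le A w (c : L) : (A w -> c = \top) -> crisp A w <= c.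
Proof.
move=> Ac; rewrite -[leLHS]tensor1x.
by apply: tensor_crisp_le => /Ac ->.
Qed.

Lemma lower_cone_crisp_ge A w (c : L) :
  (forall u, A u -> c <= Lle w u) -> c <= lower_cone (crisp A) w.
Proof.
move=> cA; apply: bigmeet_ge => u; rewrite -tensor_residuum.
by apply: tensor_crisp_le; exact: cA.
Qed.

Lemma upper_cone_crisp_ge A w (c : L) :
  (forall u, A u -> c <= Lle u w) -> c <= upper_cone (crisp A) w.
Proof.
move=> cA; apply: bigmeet_ge => u; rewrite -tensor_residuum.
by apply: tensor_crisp_le; exact: cA.
Qed.

(** As [u] belongs fully to [A], the term at [u] of the meet defining the lower cone at [w] is just
    [Lle w u]. *)
Lemma is_inf_crisp_least A u :
  A u -> (forall w, A w -> Lle u w = \top) -> is_inf (crisp A) u.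
Proof.
move=> Au uA; apply/is_infP; split=> w; first by apply: crisp_le => /uA.
rewrite -[leLHS]tensorx1 -(@crispT _ L _ A u Au) tensor_residuum.
exact: (bigmeet_lb (fun x => crisp A x ⇒ Lle w x) u).
Qed.

Lemma is_sup_crisp_greatest A u :
  A u -> (forall w, A w -> Lle w u = \top) -> is_sup (crisp A) u.
Proof.
move=> Au uA; apply/is_supP; split=> w; first by apply: crisp_le => /uA.
rewrite -[leLHS]tensorx1 -(@crispT _ L _ A u Au) tensor_residuum.
exact: (bigmeet_lb (fun x => crisp A x ⇒ Lle x w) u).
Qed.

Lemma is_inf_crisp1 u : is_inf (crisp [set u]) u.
Proof. by apply: is_inf_crisp_least => // w ->; exact: Lle_refl. Qed.

Lemma is_sup_crisp1 u : is_sup (crisp [set u]) u.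
Proof. by apply: is_sup_crisp_greatest => // w ->; exact: Lle_refl. Qed.

Lemma is_inf_crisp2 u v : Lle u v = \top -> is_inf (crisp [set u; v]) u.
Proof.
move=> uv; apply: is_inf_crisp_least; first by left.
by move=> w [->|->//]; exact: Lle_refl.
Qed.

Lemma is_inf_crisp2r u v : Lle v u = \top -> is_inf (crisp [set u; v]) v.
Proof. by rewrite setUC; exact: is_inf_crisp2. Qed.

Lemma is_sup_crisp2 u v : Lle v u = \top -> is_sup (crisp [set u; v]) u.
Proof.
move=> uv; apply: is_sup_crisp_greatest; first by left.
by move=> w [->|->//]; exact: Lle_refl.
Qed.

Lemma is_sup_crisp2r u v : Lle u v = \top -> is_sup (crisp [set u; v]) v.
Proof. by rewrite setUC; exact: is_sup_crisp2. Qed.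

Lemma Linterval_sub v u v' u' : Lle v' v = \top -> Lle u u' = \top ->
  Lsubset (Linterval v u) (Linterval v' u').
Proof.
by move=> v'v uu' w; apply: leI2; [exact: Lle_trans1|exact: Lle_trans2].
Qed.

End InfSup.

(** * Binary meets and joins, and retraction onto an interval *)

Section CompleteTolerance.
Context {d : Order.disp_t} {L : completeResiduatedLatticeType d}.
Context {U : LorderedSet L} (HU : completely_lattice U).
Implicit Types (B V : U -> L) (u v w x y : U).

(** The last clause is the universal property of the meet in every degree, not only in degree
    [\top]. *)
Lemma meet_ex u v : exists m, [/\ Lle m u = \top, Lle m v = \top,
  is_inf (crisp [set u; v]) m & forall w, Lle w u `&` Lle w v <= Lle w m].
Proof.
have [m minf] := (HU (crisp [set u; v])).1.
have [lb glb] := (is_infP _ _).1 minf.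
exists m; split=> //.
- by apply: top_le; rewrite (le_trans _ (lb u))// crispT//; left.
- by apply: top_le; rewrite (le_trans _ (lb v))// crispT//; right.
move=> w; apply: le_trans (glb w); apply: lower_cone_crisp_ge.
by move=> _ [->|->]; [exact: leIl|exact: leIr].
Qed.

Lemma join_ex u v : exists j, [/\ Lle u j = \top, Lle v j = \top &
  forall w, Lle u w `&` Lle v w <= Lle j w].
Proof.
have [j jsup] := (HU (crisp [set u; v])).2.
have [ub lub] := (is_supP _ _).1 jsup.
exists j; split=> //.
- by apply: top_le; rewrite (le_trans _ (ub u))// crispT//; left.
- by apply: top_le; rewrite (le_trans _ (ub v))// crispT//; right.
move=> w; apply: le_trans (lub w); apply: upper_cone_crisp_ge.
by move=> _ [->|->]; [exact: leIl|exact: leIr].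
Qed.

(* The witness is [(x /\ u) \/ v]. *)
Lemma Linterval_retract v u x : Lle v u = \top ->
  exists y, [/\ Lle v y = \top, Lle y u = \top & Linterval v u x <= Leq y x].
Proof.
move=> vu; have [m [mx mu _ glb]] := meet_ex x u.
have [y [my vy lub]] := join_ex m v.
exists y; split=> //.
  by apply: top_le; rewrite (le_trans _ (lub u))// mu vu meetxx.
apply: le_trans (Lle_antisym y x); apply: leI2.
  by rewrite (le_trans _ (lub x))// mx meet1x.
apply: (le_trans _ (Lle_trans2 x my)).
by rewrite (le_trans _ (glb x))// Lle_refl meet1x.
Qed.

(** * Completeness of the tolerance and fixpoints *)

Variable R : U -> U -> L.
Hypotheses (Rtol : Ltolerance R) (Rcomplete : complete_rel HU R).

(** By uniqueness of infima, completeness applies to any infimum, not just the chosen [Linf]. *)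
Lemma complete_is_inf V1 V2 u1 u2 :
  is_inf V1 u1 -> is_inf V2 u2 -> power_rel R V1 V2 <= R u1 u2.
Proof.
have [_ Rinf _] := Rcomplete.
move=> /is_inf_unique -/(_ _ (LinfP HU V1)) ->.
by move=> /is_inf_unique -/(_ _ (LinfP HU V2)) ->.
Qed.

Lemma complete_is_sup V1 V2 u1 u2 :
  is_sup V1 u1 -> is_sup V2 u2 -> power_rel R V1 V2 <= R u1 u2.
Proof.
have [_ _ Rsup] := Rcomplete.
move=> /is_sup_unique -/(_ _ (LsupP HU V1)) ->.
by move=> /is_sup_unique -/(_ _ (LsupP HU V2)) ->.
Qed.

Lemma complete_is_inf2 u1 u2 v1 v2 m n : R u1 v1 = \top -> R u2 v2 = \top ->
  is_inf (crisp [set u1; u2]) m -> is_inf (crisp [set v1; v2]) n ->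
  R m n = \top.
Proof.
move=> R1 R2 mi ni; apply/top_le/(le_trans _ (complete_is_inf mi ni)).
exact: power_rel_crisp2.
Qed.

Lemma complete_is_sup2 u1 u2 v1 v2 m n : R u1 v1 = \top -> R u2 v2 = \top ->
  is_sup (crisp [set u1; u2]) m -> is_sup (crisp [set v1; v2]) n ->
  R m n = \top.
Proof.
move=> R1 R2 mi ni; apply/top_le/(le_trans _ (complete_is_sup mi ni)).
exact: power_rel_crisp2.
Qed.

(** The singleton of [u], with infimum [u], is fully power-related to the class of [u]; reflexivity
    makes [u] itself a witness. *)
Lemma tol_infR u : R u (tol_inf HU R u) = \top.
Proof.
apply/top_le/(le_trans _ (complete_is_inf (is_inf_crisp1 u) (LinfP HU _))).
apply: (power_rel_crisp1 (y := u)); first by rewrite /Lclass Rtol.1 tensor1x.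
by move=> z; rewrite tensor1x.
Qed.

Lemma tol_supR u : R u (tol_sup HU R u) = \top.
Proof.
apply/top_le/(le_trans _ (complete_is_sup (is_sup_crisp1 u) (LsupP HU _))).
apply: (power_rel_crisp1 (y := u)); first by rewrite /Lclass Rtol.1 tensor1x.
by move=> z; rewrite tensor1x.
Qed.

Lemma tol_inf_le u w : R u w <= Lle (tol_inf HU R u) w.
Proof. by have /is_infP[lb _] := LinfP HU (Lclass R u); exact: lb. Qed.

Lemma tol_sup_ge u w : R u w <= Lle w (tol_sup HU R u).
Proof. by have /is_supP[ub _] := LsupP HU (Lclass R u); exact: ub. Qed.

Lemma tol_inf_mono u v : Lle u v = \top ->
  Lle (tol_inf HU R u) (tol_inf HU R v) = \top.
Proof.
move=> uv; have [m [_ mv minf _]] := meet_ex u (tol_inf HU R v).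
(* Meeting [u] ~ [u] with [v] ~ [tol_inf v] relates [u], the meet of [u] and [v], to [m]; hence
   [tol_inf u] is below [m]. *)
have um : R u m = \top.
  by apply: complete_is_inf2 (is_inf_crisp2 uv) minf; [exact: Rtol.1|exact: tol_infR].
apply: top_le; apply: le_trans (Lle_trans2 _ mv).
by rewrite -[leLHS]um; exact: tol_inf_le.
Qed.

Lemma tol_fixpoint_tol_inf u :
  tol_fixpoint HU R (tol_sup HU R (tol_inf HU R u)) (tol_inf HU R u).
Proof.
set v := tol_inf HU R u; set u' := tol_sup HU R v; split=> //.
(* [tol_inf u'] is below [v] because [u'] ~ [v]; conversely [u] ~ [v] puts [u] below [u'], and
   [tol_inf] is monotone. *)
apply: Lle_anti.
  by apply: top_le; apply: le_trans (tol_inf_le _ _); rewrite Rtol.2 tol_supR.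
apply: tol_inf_mono; apply: top_le; apply: le_trans (tol_sup_ge _ _).
by rewrite Rtol.2 tol_infR.
Qed.

(** * Blocks and intervals *)

Lemma Linterval_block v u :
  Lle v u = \top -> R u v = \top -> block R (Linterval v u).
Proof.
move=> vu Ruv.
(* Meet [z] ~ [z] with [u] ~ [v]: the two sides become [z] and [v]. *)
have Rv z : Lle v z = \top -> Lle z u = \top -> R z v = \top.
  move=> vz zu.
  exact: complete_is_inf2 (Rtol.1 z) Ruv (is_inf_crisp2 zu) (is_inf_crisp2r vz).
move=> x y.
have [x' [vx' x'u x'x]] := Linterval_retract x vu.
have [y' [vy' y'u y'y]] := Linterval_retract y vu.
have Rvy' : R v y' = \top by rewrite Rtol.2 Rv.
(* Join [x'] ~ [v] with [v] ~ [y']: the two sides become [x'] and [y']. *)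
have Rxy' : R x' y' = \top.
  exact: complete_is_sup2 (Rv x' vx' x'u) Rvy'
    (is_sup_crisp2 vx') (is_sup_crisp2r vy').
have [Rcompat _ _] := Rcomplete.
(* Compatibility moves from [x'], [y'] to [x], [y] at the cost of two equality degrees, which
   dominate the interval degrees. *)
apply: le_trans (Rcompat x' y' x y).
by rewrite Rxy' tensor1x; exact: le_tensor.
Qed.

(** The block condition power-relates the singleton of [x] to [B] in degree at least [B x], with [x]
    as its own witness. *)
Lemma block_Linf B x : block R B -> B x <= R x (Linf HU B).
Proof.
move=> blB; apply: le_trans (complete_is_inf (is_inf_crisp1 x) (LinfP HU B)).
apply: (power_rel_crisp1 (y := x)); first by rewrite Rtol.1 tensor1x.
by move=> z; exact: blB.
Qed.

Lemma block_Lsup B x : block R B -> B x <= R x (Lsup HU B).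
Proof.
move=> blB; apply: le_trans (complete_is_sup (is_sup_crisp1 x) (LsupP HU B)).
apply: (power_rel_crisp1 (y := x)); first by rewrite Rtol.1 tensor1x.
by move=> z; exact: blB.
Qed.

(* [Linf B] and [Lsup B] need not be related when [B] is empty, hence the
   supremum of [B] with [Linf B] adjoined. *)
Lemma block_sub_Linterval B : block R B ->
  exists u v, R u v = \top /\ Lsubset B (Linterval v u).
Proof.
move=> blB; set v := Linf HU B.
pose B' x := if `[< x = v >] then \top else B x.
(* Adjoining [v] keeps a block since [block_Linf] bounds [B x] by [R x v]. *)
have blB' : block R B'.
  move=> x y; rewrite /B'; case: asboolP => [->|_]; case: asboolP => [->|_].
  - by rewrite Rtol.1 lex1.
  - by rewrite tensor1x Rtol.2 block_Linf.
  - by rewrite tensorx1 block_Linf.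
  - exact: blB.
have BB' : Lsubset B B' by move=> x; rewrite /B'; case: asboolP => // _; exact: lex1.
exists (Lsup HU B'), v; split.
  rewrite Rtol.2; apply: top_le; apply: le_trans (block_Lsup v blB').
  by rewrite /B'; case: asboolP.
have /is_infP[lb _] := LinfP HU B; have /is_supP[ub _] := LsupP HU B'.
by move=> x; rewrite /Linterval lexI lb (le_trans (BB' x)).
Qed.

Lemma block_sub_tol_fixpoint B : block R B ->
  exists u v, tol_fixpoint HU R u v /\ Lsubset B (Linterval v u).
Proof.
move=> /block_sub_Linterval[u [v [Ruv Buv]]].
set v' := tol_inf HU R u; exists (tol_sup HU R v'), v'.
split; first exact: tol_fixpoint_tol_inf.
move=> x; apply: (le_trans (Buv x)); apply: Linterval_sub.
  by apply: top_le; rewrite -[leLHS]Ruv; exact: tol_inf_le.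
by apply: top_le; apply: le_trans (tol_sup_ge _ _); rewrite Rtol.2 tol_infR.
Qed.

Lemma tol_fixpoint_block u v :
  tol_fixpoint HU R u v -> block R (Linterval v u).
Proof.
move=> uv; apply: Linterval_block; first exact: fixpoint_Lle uv.
by case: uv => <- _; exact: tol_infR.
Qed.

(** A larger block contains both endpoints fully, so each of its elements is similar to [u] and to
    [v] at least in its membership degree; it then lies above [tol_inf u] and below [tol_sup v] in
    that degree. *)
Lemma tol_fixpoint_maximal u v :
  tol_fixpoint HU R u v -> maximal_block R (Linterval v u).
Proof.
move=> fuv; split; first exact: tol_fixpoint_block.
have vu := fixpoint_Lle Rtol fuv.
move=> B blB subB.
have Bu : B u = \top.
  by apply/top_le/(le_trans _ (subB u)); rewrite /Linterval vu Lle_refl meetxx.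
have Bv : B v = \top.
  by apply/top_le/(le_trans _ (subB v)); rewrite /Linterval vu Lle_refl meetxx.
apply/funext => x; apply/eqP; rewrite eq_le subB andbT /Linterval lexI.
case: fuv => fv fu; apply/andP; split.
  by rewrite -fv (le_trans _ (tol_inf_le _ _))// -[leLHS]tensor1x -Bu; exact: blB.
by rewrite -fu (le_trans _ (tol_sup_ge _ _))// -[leLHS]tensor1x -Bv; exact: blB.
Qed.

End CompleteTolerance.

Theorem theorem12 (d : Order.disp_t) (L : completeResiduatedLatticeType d)
    (U : LorderedSet L) (HU : completely_lattice U) (R : U -> U -> L)
    (Rtol : Ltolerance R) (Rcomplete : complete_rel HU R) (B : U -> L) :
  maximal_block R B <->
  exists u v : U, tol_fixpoint HU R u v /\ B = Linterval v u.
Proof.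
split=> [[blB maxB]|[u [v [uv ->]]]]; last exact: tol_fixpoint_maximal uv.
(* The enclosing fixpoint interval is a block, so maximality of [B] forces equality. *)
have [u [v [uv Buv]]] := block_sub_tol_fixpoint Rtol Rcomplete blB.
exists u, v; split=> //.
by rewrite (maxB _ (tol_fixpoint_block Rtol Rcomplete uv) Buv).
Qed.
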